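(* Let $\epsilon>0$ be real, let $N>k\ge 1$ be integers, let $p>k$ be a prime, and put $R=\frac{k}{N}$. Let $L\ge 1$ be an integer with $L>\frac{1-R-\epsilon}{\epsilon}$ and let $s\ge1$ be an integer with $s\mid N$ and $$s>\frac{L(L-1)R}{\epsilon L-(1-R-\epsilon)}+L-1.$$ Let $n=\frac{N}{s}$ and let $\alpha_1,\dots,\alpha_n\in\mathbb{F}_p$ be pairwise distinct. Then the order-$s$ univariate multiplicity code $\mathsf{MULT}_{n,k}^{(s)}(\alpha_1,\dots,\alpha_n)$ over the alphabet $\mathbb{F}_p^s$ is $(1-R-\epsilon,L)$ list-decodable.
   Context: Hasse derivatives: for a polynomial $f(X)$ over a field, the $i$-th Hasse derivative $f^{(i)}(X)$ is the coefficient of $Z^i$ in the expansion $f(X+Z)=\sum_{i\ge0}f^{(i)}(X)Z^i$. Univariate multiplicity code of order $s$: $\mathsf{MULT}_{n,k}^{(s)}(\alpha_1,\dots,\alpha_n)=\{\mathcal{M}(f): f\in\mathbb{F}_p[x],\ \deg f<k\}\subseteq(\mathbb{F}_p^s)^n$, where $\mathcal{M}(f)=(F_1,\dots,F_n)$ and $F_i=(f(\alpha_i),f^{(1)}(\alpha_i),\dots,f^{(s-1)}(\alpha_i))\in\mathbb{F}_p^s$. Its rate is $R=\frac{k}{sn}$. List-decodability: a code $C\subseteq\Sigma^n$ is $(\rho,L)$ list-decodable if for every $y\in\Sigma^n$ there are at most $L$ codewords $c\in C$ that differ from $y$ in at most a $\rho$ fraction of the $n$ coordinates. (If $\rho<0$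 this holds vacuously.) *)

(* Defs.v *)
From HB Require Import structures.
From mathcomp Require Import all_boot all_order all_algebra.
From mathcomp Require Import reals.

Set Implicit Arguments.
Unset Strict Implicit.
Unset Printing Implicit Defensive.

Import Order.TTheory GRing.Theory Num.Theory.
Local Open Scope ring_scope.

(* MathComp's nderivn f^`N(i) is the i-th Hasse derivative: it is the
   coefficient of Z^i in f(X + Z), where the outer variable 'X of
   {poly {poly F}} is Z and the inner one, 'X%:P, is X. *)
Lemma hasseE (F : fieldType) (f : {poly F}) (i : nat) :
  f^`N(i) = (f^:P \Po ('X + 'X%:P))`_i.
Proof.
rewrite -[in LHS](coefK f) poly_def linear_sum /= comp_polyE size_map_polyC.
rewrite coef_sum; apply: eq_bigr => j _.
rewrite linearZ /= nderivnXn coefZ coef_map /= mul_polyC; congr (_ *: _).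
rewrite addrC exprDn coef_sum.
under eq_bigr => m _ do rewrite coefMn -polyC_exp coefCM coefXn.
have [lt_ji | le_ij] := ltnP j i.
  rewrite bin_small // mulr0n big1 // => m _.
  by rewrite gtn_eqF ?mulr0 ?mul0rn // (leq_trans (ltn_ord m)).
have lt_ij : (i < j.+1)%N by [].
rewrite (bigD1 (Ordinal lt_ij)) //= eqxx mulr1 big1 ?addr0 // => m ne_mi.
by rewrite eq_sym -val_eqE /= in ne_mi; rewrite (negbTE ne_mi) mulr0 mul0rn.
Qed.

Definition mult_enc (F : finFieldType) (n s : nat) (alpha : 'I_n -> F)
    (f : {poly F}) : {ffun 'I_n -> 'rV[F]_s} :=
  [ffun i => \row_(j < s) (f^`N(j)).[alpha i]].

(* {poly_k F} is the type of polynomials of degree < k (size at most k). *)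
Definition mult_code (F : finFieldType) (n k s : nat) (alpha : 'I_n -> F) :
    {set {ffun 'I_n -> 'rV[F]_s}} :=
  [set mult_enc s alpha f | f : {poly_k F}].

Lemma mult_codeP (F : finFieldType) (n k s : nat) (alpha : 'I_n -> F) c :
  reflect (exists2 f : {poly F}, (size f <= k)%N & c = mult_enc s alpha f)
          (c \in mult_code k s alpha).
Proof.
apply: (iffP imsetP) => [[f _ ->] | [f sz_f ->]].
  by exists f; rewrite ?size_npoly.
by exists (npolyp k f); rewrite ?inE // npolypK.
Qed.

Definition rel_dist (R : realType) (n : nat) (Sigma : finType)
    (x y : {ffun 'I_n -> Sigma}) : R :=
  #|[set i | x i != y i]|%:R / n%:R.

Definition list_decodable (R : realType) (n : nat) (Sigma : finType)
    (C : {set {ffun 'I_n -> Sigma}}) (rho : R) (L : nat) : Prop :=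
  forall y : {ffun 'I_n -> Sigma},
    (#|[set c in C | (rel_dist R c y <= rho)%R]| <= L)%N.

(* Main.v *)
Require Import Defs.
From HB Require Import structures.
From mathcomp Require Import all_boot all_order all_algebra.
From mathcomp Require Import reals.
From mathcomp Require Import ring lra zify.

(* Let [H_i] be the space of polynomials of degree [< k] divisible by
   [(X - alpha_i)^s].  The Hasse-Wronskian of a [t]-dimensional space [U] of such
   polynomials is nonzero (this uses [k < p]), has degree at most [t k], and
   vanishes at [alpha_i] to order at least [(s + 1 - t) dim (U :&: H_i)].  Hence
   [\sum_i dim (U :&: H_i) <= D dim U] with [D = k / (s + 1 - L)] for [t <= L].

   Suppose a word [y] is close to the [L + 1] polynomials in a set [T], and let
   [S_i] be the members of [T] that agree with [y] at [i], so that [S_i] lies in a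
   coset of [H_i].  If [T] is affinely independent, [#|S_i| - 1] is at most the
   dimension of [U :&: H_i] for [U] the span of the differences, and therefore
   [\sum_i (#|S_i| - 1) <= D L], which contradicts the choice of [s].
   The same inequality holds without independence, even with weights: as long as
   two indices carry weight, weight can be moved from one to the other without
   decreasing the left-hand side until one of them dies or some proper subspace
   [U] satisfies its dimension constraint with equality.  In the latter case the
   inequality splits into the one inside the cosets of [U] and the one for the
   quotient by [U].  With a single weighted index it is trivial. *)

Set Implicit Arguments.
Unset Strict Implicit.
Unset Printing Implicit Defensive.

Import Order.TTheory GRing.Theory Num.Theory.
Local Open Scope ring_scope.

(** * Agreement counts and subspace dimensions *)

(* [x *m cokermx A] labels the coset of [x] modulo the row space of [A], so this
   counts the cosets of [A] that meet [X]. *)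
Definition nclass (F : finFieldType) d (A : 'M[F]_d) (X : {set 'rV[F]_d}) : nat :=
  #|[set x *m cokermx A | x in X]|.

Lemma eq_cokermx (F : fieldType) d (A : 'M[F]_d) (x y : 'rV[F]_d) :
  (x *m cokermx A == y *m cokermx A) = (x - y <= A)%MS.
Proof. by rewrite submxE mulmxBl subr_eq0. Qed.

(** The coset modulo [U] is a linear function of the coset modulo [A]; a pseudo-inverse of
    [cokermx A] supplies the connecting map. *)
Lemma cokermx_factor (F : fieldType) d (A U : 'M[F]_d) (x : 'rV[F]_d) :
  (A <= U)%MS ->
  x *m cokermx A *m (pinvmx (cokermx A) *m cokermx U) = x *m cokermx U.
Proof.
move=> sAU; apply/eqP; rewrite mulmxA eq_cokermx (submx_trans _ sAU) //.
by rewrite -eq_cokermx mulmxKpV ?submxMl.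
Qed.

Lemma nclass_sub (F : finFieldType) d (A : 'M[F]_d) (X Y : {set 'rV[F]_d}) :
  X \subset Y -> (nclass A X <= nclass A Y)%N.
Proof. by move=> sXY; apply/subset_leq_card/imsetS. Qed.

Lemma nclass_le1 (F : finFieldType) d (A : 'M[F]_d) (X : {set 'rV[F]_d}) :
  (forall x y, x \in X -> y \in X -> (x - y <= A)%MS) -> (nclass A X <= 1)%N.
Proof.
move=> sXA; apply/card_le1_eqP => _ _ /imsetP[x Xx ->] /imsetP[y Xy ->].
by apply/eqP; rewrite eq_cokermx sXA.
Qed.

(** Group the [A]-cosets by the [U]-coset containing them: a nonempty group of [m] contributes
    [1 + (m - 1)]. Truncated predecessors cover empty groups and empty [X]. *)
Lemma nclass_split (F : finFieldType) d (A U : 'M[F]_d) (X : {set 'rV[F]_d}) :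
  (A <= U)%MS ->
  (nclass A X).-1 = ((nclass U X).-1 +
    \sum_(a : 'rV[F]_d) (nclass A (X :&: [set x | x *m cokermx U == a])).-1)%N.
Proof.
move=> sAU; pose g (y : 'rV[F]_d) := y *m (pinvmx (cokermx A) *m cokermx U).
have fibre a : [set y in [set x *m cokermx A | x in X] | g y == a]
    = [set x *m cokermx A | x in X :&: [set x | x *m cokermx U == a]].
  apply/setP=> y; rewrite inE; apply/andP/imsetP.
    case=> /imsetP[x Xx ->] gxa; exists x => //; rewrite !inE Xx /=.
    by rewrite -(cokermx_factor _ sAU).
  case=> x /setIP[Xx]; rewrite inE -(cokermx_factor _ sAU) => gxa ->.
  by split=> //; apply/imsetP; exists x.
have cA : nclass A X =
    (\sum_a nclass A (X :&: [set x | x *m cokermx U == a]))%N.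
  rewrite /nclass -sum1_card (partition_big g xpredT) //=.
  apply: eq_bigr => a _; rewrite -fibre sum1_card.
  by apply: eq_card => y; rewrite !inE.
have cU : nclass U X =
    (\sum_a (0 < nclass A (X :&: [set x | x *m cokermx U == a])))%N.
  rewrite /nclass -sum1_card big_mkcond /=; apply: eq_bigr => a _.
  rewrite card_gt0 imset_eq0; case: ifP => [/imsetP[x Xx ->]|aX].
    by case: set0Pn => // -[]; exists x; rewrite !inE Xx eqxx.
  case: set0Pn => // -[x]; rewrite !inE => /andP[Xx /eqP xa].
  by case/imsetP: aX; exists x.
have eqAU : nclass A X = (nclass U X +
    \sum_(a : 'rV[F]_d) (nclass A (X :&: [set x | x *m cokermx U == a])).-1)%N.
  by rewrite cA cU -big_split; apply: eq_bigr => a _ /=; case: (nclass _ _).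
have : (nclass U X == 0)%N = (nclass A X == 0)%N.
  by rewrite /nclass !cards_eq0 !imset_eq0.
by rewrite eqAU; case: (nclass U X) => [|n] //=; rewrite !add0n => /esym/eqP ->.
Qed.

(* Largest step along a direction [c] that keeps all the slacks nonnegative. *)
Lemma max_step (R : realFieldType) (J : finType) (g c : J -> R) (j0 : J) :
  (forall j, 0 <= g j) -> 0 < c j0 ->
  exists2 t : R, 0 <= t & (forall j, t * c j <= g j) /\
    exists2 j, 0 < c j & t * c j = g j.
Proof.
move=> g0 c0.
case: (@Order.TotalTheory.arg_minP _ _ _ j0 (fun j => 0 < c j)
  (fun j => g j / c j)) => // j cj min.
exists (g j / c j); first by rewrite divr_ge0 ?g0 ?(ltW cj).
split; last by exists j => //; rewrite divfK ?gt_eqF.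
move=> i; case: (ltP 0 (c i)) => [ci|ci].
  by rewrite -ler_pdivlMr // min.
by apply: le_trans (g0 i); rewrite mulr_ge0_le0 // divr_ge0 ?g0 ?(ltW cj).
Qed.

(** * Weight transfer and splitting along tight subspaces *)

Section WeightedSplitting.

Variables (F : finFieldType) (R : realFieldType) (d : nat) (I : finType).
Variables (H : I -> 'M[F]_d) (S : I -> {set 'rV[F]_d}) (D : R).

(* Dimension of the trace of [H i] on the quotient [U / A]. *)
Definition relrank (i : I) (A U : 'M[F]_d) : R :=
  (\rank (U :&: H i)%MS)%:R - (\rank (A :&: H i)%MS)%:R.

Definition slack (w : I -> R) (A U : 'M[F]_d) : R :=
  D * ((\rank U)%:R - (\rank A)%:R) - \sum_i w i * relrank i A U.

Definition feasible (A B : 'M[F]_d) (w : I -> R) : Prop :=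
  forall U : 'M[F]_d, (A <= U)%MS -> (U <= B)%MS -> 0 <= slack w A U.

Definition agreement_bound (A B : 'M[F]_d) (w : I -> R) : Prop :=
  forall T : {set 'rV[F]_d},
    (forall x y, x \in T -> y \in T -> (x - y <= B)%MS) ->
    \sum_i w i * (nclass A (S i :&: T)).-1%:R <= D * (nclass A T).-1%:R.

(** Additivity makes feasibility pass to the quotient by a subspace of slack zero. *)
Lemma slackD w A U V : slack w A V = slack w A U + slack w U V.
Proof.
rewrite /slack addrACA -opprD -mulrDr -big_split /=; congr (_ * _ - _).
  by rewrite [RHS]addrC subrKA.
by apply: eq_bigr => i _; rewrite -mulrDr /relrank [in RHS]addrC subrKA.
Qed.

Lemma relrank_ge0 i A U : (A <= U)%MS -> 0 <= relrank i A U.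
Proof. by move=> sAU; rewrite subr_ge0 ler_nat mxrankS ?capmxS. Qed.

(** The bound above [U] is applied to [T] itself, the bound below [U] to each piece of [T] inside a
    coset of [U]. *)
Lemma agreement_bound_split A U B w :
  (A <= U)%MS -> agreement_bound A U w -> agreement_bound U B w ->
  agreement_bound A B w.
Proof.
move=> sAU bAU bUB T TB; rewrite (nclass_split T sAU) natrD mulrDr.
under eq_bigr => i _ do rewrite (nclass_split _ sAU) natrD mulrDr.
rewrite big_split /= lerD ?bUB //.
rewrite natr_sum mulr_sumr.
under eq_bigr => i _ do rewrite natr_sum mulr_sumr.
rewrite exchange_big /=; apply: ler_sum => a _.
under eq_bigr => i _ do rewrite -setIA.
apply: bAU => x y; rewrite !inE => /andP[_ /eqP xa] /andP[_ /eqP ya].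
by rewrite -eq_cokermx xa ya.
Qed.

(** Differences in [S i :&: T] lie in [B :&: H i], which equality of ranks forces into [A]; hence at
    most one [A]-coset is met. *)
Lemma relrank_eq0 i A B (T : {set 'rV[F]_d}) :
  (forall x y, x \in S i -> y \in S i -> (x - y <= H i)%MS) ->
  (A <= B)%MS ->
  (forall x y, x \in T -> y \in T -> (x - y <= B)%MS) ->
  relrank i A B = 0 -> (nclass A (S i :&: T)).-1 = 0%N.
Proof.
move=> SH sAB TB /eqP; rewrite subr_eq0 eqr_nat => /eqP eqr.
have sBA : (B :&: H i <= A)%MS.
  have s2 : (B :&: H i <= A :&: H i)%MS.
    rewrite -(geq_leqif (mxrank_leqif_sup (capmxS sAB (submx_refl (H i))))).
    by rewrite eqr.
  exact: submx_trans s2 (capmxSl _ _).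
apply/eqP; rewrite -leqn0 -subn1 leq_subLR addn0.
apply: nclass_le1 => x y /setIP[Sx Tx] /setIP[Sy Ty].
by apply: submx_trans sBA; rewrite sub_capmx TB ?SH.
Qed.

Lemma feasible_weight_le i A B w :
  (A <= B)%MS -> (forall j, 0 <= w j) -> feasible A B w ->
  0 < relrank i A B -> w i <= D.
Proof.
move=> sAB w0 fw ri; set U := (A + (B :&: H i))%MS.
have sAU : (A <= U)%MS by exact: addsmxSl.
have sUB : (U <= B)%MS by rewrite addsmx_sub sAB capmxSl.
have rU : (\rank U)%:R - (\rank A)%:R = relrank i A B.
  have := mxrank_sum_cap A (B :&: H i)%MS.
  have -> : \rank (A :&: (B :&: H i))%MS = \rank (A :&: H i)%MS.
    have sAB' : (A <= A :&: B)%MS by rewrite sub_capmx submx_refl.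
    by rewrite capmxA; apply/eqP; rewrite eqn_leq !mxrankS ?capmxS ?capmxSl.
  by rewrite -/U /relrank => /(congr1 (fun m => m%:R : R)); rewrite !natrD => e; lra.
have rUi : relrank i A B <= relrank i A U.
  by rewrite lerB // ler_nat mxrankS // sub_capmx capmxSr addsmxSr.
have := fw U sAU sUB; rewrite /slack rU subr_ge0 (bigD1 i) //= => le_D.
have : w i * relrank i A B <= D * relrank i A B.
  apply: le_trans le_D; apply: le_trans (ler_wpM2l (w0 i) rUi) _.
  by rewrite lerDl sumr_ge0 // => j _; rewrite mulr_ge0 ?relrank_ge0.
by rewrite ler_pM2r.
Qed.

(** Indices with zero [relrank] are left out because they contribute nothing, by [relrank_eq0]. *)
Definition support (A B : 'M[F]_d) (w : I -> R) : {set I} :=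
  [set i | (w i != 0) && (0 < relrank i A B)].

Definition transfer (w : I -> R) (i j : I) (x y : R) (l : I) : R :=
  w l + (l == i)%:R * x - (l == j)%:R * y.

Lemma sum_transfer w i j x y (o : I -> R) :
  \sum_l transfer w i j x y l * o l = \sum_l w l * o l + x * o i - y * o j.
Proof.
under eq_bigr => l _ do rewrite mulrBl mulrDl.
rewrite big_split sumrN big_split /=; congr (_ + _ - _).
  by rewrite (bigD1 i) //= big1 => [|l /negPf->];
    rewrite ?eqxx ?mul1r ?addr0 ?mul0r.
by rewrite (bigD1 j) //= big1 => [|l /negPf->];
    rewrite ?eqxx ?mul1r ?addr0 ?mul0r.
Qed.

Lemma feasible_bound A B (w : I -> R) :
  0 <= D ->
  (forall i x y, x \in S i -> y \in S i -> (x - y <= H i)%MS) ->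
  (A <= B)%MS -> (forall i, 0 <= w i) -> feasible A B w ->
  agreement_bound A B w.
Proof.
move=> D0 SH; move er: (\rank B - \rank A)%N => r.
elim/ltn_ind: r A B er w => r IHr A B er w sAB.
(* A tight [U] of intermediate rank leaves two feasible intervals with smaller rank gaps, both
   settled by the outer induction. *)
have tight (v : I -> R) U : (forall i, 0 <= v i) -> feasible A B v ->
    (A <= U)%MS -> (U <= B)%MS -> (\rank A < \rank U < \rank B)%N ->
    slack v A U = 0 -> agreement_bound A B v.
  move=> v0 fv sAU sUB /andP[rAU rUB] sl0.
  apply: (agreement_bound_split sAU).
    apply: (IHr _ _ _ _ erefl) => //; first by lia.
    by move=> V sAV sVU; rewrite fv // (submx_trans sVU).
  apply: (IHr _ _ _ _ erefl) => //; first by lia.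
  move=> V sUV sVB; have := fv V (submx_trans sAU sUV) sVB.
  by rewrite (slackD _ _ U) sl0 add0r.
(* Inner induction on the number of indices that carry weight. *)
move em: #|support A B w| => m; elim/ltn_ind: m w em => m IHm w em w0 fw T TB.
pose o l : R := (nclass A (S l :&: T)).-1%:R; rewrite -/(o _).
have o0 l : 0 <= o l by rewrite ler0n.
have oNP l : l \notin support A B w -> w l * o l = 0.
  rewrite inE negb_and negbK => /orP[/eqP-> | rl]; first by rewrite mul0r.
  have /eqP rl0 : relrank l A B == 0 by rewrite eq_le relrank_ge0 // leNgt rl.
  by rewrite /o (relrank_eq0 (SH l) sAB TB rl0) mulr0.
(* Trading the weights of [i] and [j] at the rate that keeps the slack of [B]
   unchanged, in the direction that increases the left-hand side, until either
   [v j = 0] or a proper intermediate subspace becomes tight. *)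
have shift i j : i != j -> i \in support A B w -> j \in support A B w ->
    relrank i A B * o j <= relrank j A B * o i ->
    \sum_l w l * o l <= D * (nclass A T).-1%:R.
  move=> neq_ij; rewrite !inE => /andP[wi ri] /andP[wj rj] le_o.
  pose inAB (U : 'M[F]_d) := (A <= U <= B)%MS.
  (* [None] stands for the constraint that the weight of [j] stays nonnegative, [Some U] for the
     slack of [U]. Subspaces outside the interval get rate 0, so they never stop the move. *)
  pose c (J : option 'M[F]_d) := if J is Some U then
    (if inAB U
     then relrank j A B * relrank i A U - relrank i A B * relrank j A U
     else 0) else relrank i A B.
  pose g (J : option 'M[F]_d) := if J is Some U then
    (if inAB U then slack w A U else 0) else w j.
  have g0 J : 0 <= g J.
    case: J => [U|] //=; rewrite /inAB; case: ifP => // /andP[]; exact: fw.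
  have [t t0 [tg [J cJ tJ]]] := max_step (c := c) (j0 := None) g0 ri.
  pose v := transfer w i j (t * relrank j A B) (t * relrank i A B).
  have sv U : inAB U -> slack v A U = g (Some U) - t * c (Some U).
    by move=> abU; rewrite /g /c abU /slack sum_transfer; ring.
  have v0 l : 0 <= v l.
    have tj := tg None; rewrite /v /transfer.
    have [->|_] := eqVneq l j; last first.
      by rewrite mul0r subr0 addr_ge0 // mulr_ge0 // mulr_ge0 // ltW.
    by rewrite eq_sym (negPf neq_ij) mul0r addr0 mul1r subr_ge0.
  have fv : feasible A B v.
    by move=> U sAU sUB; rewrite sv ?subr_ge0 ?tg // /inAB sAU.
  have le_wv : \sum_l w l * o l <= \sum_l v l * o l.
    by rewrite sum_transfer -!mulrA -addrA -mulrBr lerDl mulr_ge0 // subr_ge0.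
  apply: le_trans le_wv _.
  case: J cJ tJ => [U|] cJ tJ; last first.
    have vj : v j = 0.
      rewrite /v /transfer eqxx eq_sym (negPf neq_ij) mul0r addr0 mul1r.
      by move: tJ => /= ->; rewrite subrr.
    apply: (IHm #|support A B v| _ v erefl v0 fv T TB).
    rewrite -em; apply/proper_card/properP; split.
      apply/subsetP => l; rewrite !inE => /andP[vl ->]; rewrite andbT.
      have [->|li] := eqVneq l i; first exact: wi.
      have [->|lj] := eqVneq l j; first exact: wj.
      apply: contraNneq vl => wl.
      by rewrite /v /transfer (negPf li) (negPf lj) wl !mul0r addr0 subr0.
    by exists j; rewrite !inE ?wj ?rj // vj eqxx.
  have abU : inAB U by move: cJ => /=; case: ifP; rewrite ?ltxx.
  have /andP[sAU sUB] := abU.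
  apply: (tight v U v0 fv sAU sUB) TB; last by rewrite sv // tJ subrr.
  move: cJ; rewrite /= abU => cJ.
  (* The positive rate of [U] excludes the ends: at [A] both relative ranks vanish, at [B] the two
     terms cancel. *)
  apply/andP; split; rewrite ltnNge; apply/negP => le_r.
    have /andP[_ sUA] : (A <= U <= A)%MS.
      by rewrite sAU -(geq_leqif (mxrank_leqif_sup sAU)).
    have r0 l : relrank l A U = 0.
      by apply/eqP; rewrite subr_eq0 eqr_nat eqn_leq !mxrankS ?capmxS.
    by rewrite !r0 !mulr0 subrr ltxx in cJ.
  have sBU : (B <= U)%MS by rewrite -(geq_leqif (mxrank_leqif_sup sUB)).
  have rB l : relrank l A U = relrank l A B.
    congr (_ - _); congr (_%:R).
    by apply/eqP; rewrite eqn_leq !mxrankS ?capmxS.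
  by rewrite !rB mulrC subrr ltxx in cJ.
have [P0|[i Pi]] := set_0Vmem (support A B w).
  by rewrite big1 ?mulr_ge0 // => l _; rewrite oNP // P0 inE.
have [Pi0|[j /setD1P[ji Pj]]] := set_0Vmem (support A B w :\ i).
  rewrite (bigD1 i) //= big1 ?addr0; last first.
    move=> l li; apply: oNP; apply/negP => Pl.
    by move/setP/(_ l): Pi0; rewrite in_setD1 li Pl inE.
  move: Pi; rewrite inE => /andP[_ ri].
  apply: ler_pM => //; first exact: feasible_weight_le fw ri.
  by rewrite ler_nat -!subn1 leq_sub2r // nclass_sub // subsetIr.
case/orP: (le_total (relrank i A B * o j) (relrank j A B * o i)) => le_o.
  by apply: (shift i j) => //; rewrite eq_sym.
exact: (shift j i).
Qed.

End WeightedSplitting.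

(** * Hasse-Wronskians and the dimension bound *)

Lemma coefM_top (R : nzRingType) (p q : {poly R}) (c e : nat) :
  (size p <= c.+1)%N -> (size q <= e.+1)%N -> (p * q)`_(c + e) = p`_c * q`_e.
Proof.
move=> sp sq; have ltc : (c < (c + e).+1)%N by lia.
rewrite coefM (bigD1 (Ordinal ltc)) //= addKn big1 ?addr0 // => j.
rewrite -val_eqE /= => ne_jc.
have [cj|jc] := ltnP c j; first by rewrite [p`_j]nth_default ?mul0r // (leq_trans sp).
by rewrite [q`_(_ - _)]nth_default ?mulr0 // (leq_trans sq) //; move/eqP: ne_jc; lia.
Qed.

Lemma coefXnM_nderivn (R : nzRingType) (p : {poly R}) (i e : nat) :
  ('X^i * p^`N(i))`_e = p`_e *+ 'C(e, i).
Proof.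
rewrite coefXnM; case: ltnP => [lt_ei|le_ie]; first by rewrite bin_small ?mulr0n.
by rewrite coef_nderivn subnKC.
Qed.

Lemma nderivn_nderivn (R : nzRingType) (p : {poly R}) (i j : nat) :
  p^`N(i)^`N(j) = p^`N(i + j) *+ 'C(i + j, i).
Proof.
apply/polyP => e; rewrite coefMn !coef_nderivn -!mulrnA addnA; congr (_ *+ _).
(* After multiplication by [i! j! e!], both products of binomials become [(i + j + e)!]. *)
apply/eqP; rewrite -(eqn_pmul2r (fact_gt0 i)) -(eqn_pmul2r (fact_gt0 j)).
rewrite -(eqn_pmul2r (fact_gt0 e)).
have h1 := bin_fact (leq_addr (j + e) i); rewrite addKn in h1.
have h2 := bin_fact (leq_addr e j); rewrite addKn in h2.
have h3 := bin_fact (leq_addr e (i + j)); rewrite addKn in h3.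
have h4 := bin_fact (leq_addr j i); rewrite addKn in h4.
rewrite -addnA in h3 |- *.
apply/eqP; transitivity ((i + (j + e))`!)%N.
  by rewrite -h1 -h2; ring.
by rewrite -h3 -h4; ring.
Qed.

Lemma dvdp_XsubC_exp_nderivn (F : fieldType) (p : {poly F}) (a : F) (m : nat) :
  (forall j, (j < m)%N -> p^`N(j).[a] = 0) -> ('X - a%:P) ^+ m %| p.
Proof.
move=> pa0.
(* Taylor expansion at [a]: the terms of index below [m] vanish. *)
have -> : p = \sum_(j < size p) p^`N(j).[a] *: ('X - a%:P) ^+ j.
  rewrite -[LHS]comp_polyXr -[X in p \Po X](subrKC a%:P) /comp_poly.
  rewrite nderiv_taylor; last exact: mulrC.
  rewrite size_map_polyC; apply: eq_bigr => j _.
  by rewrite nderivn_map horner_map -mul_polyC.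
apply: (big_ind (fun q => ('X - a%:P) ^+ m %| q)); [exact: dvdp0|exact: dvdp_add|].
move=> j _; have [jm|mj] := ltnP j m; first by rewrite pa0 // scale0r dvdp0.
by rewrite -mul_polyC dvdp_mull ?dvdp_exp2l.
Qed.

Lemma det_dvdp (F : fieldType) (t : nat) (M : 'M[{poly F}]_t) (g : 'I_t -> {poly F}) :
  (forall i j, g i %| M i j) -> \prod_i g i %| \det M.
Proof.
move=> gM; apply: (big_ind (fun q => _ %| q)); [exact: dvdp0|exact: dvdp_add|].
move=> s _; apply: dvdp_mull.
apply: (big_ind2 (fun p q : {poly F} => p %| q)) => [|p1 q1 p2 q2|i _].
- exact: dvdpp.
- exact: dvdp_mul.
- exact: gM.
Qed.

Lemma prod_dvdp (F : fieldType) (n : nat) (g : 'I_n -> {poly F}) (p : {poly F}) :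
  (forall i j, i != j -> coprimep (g i) (g j)) -> (forall i, g i %| p) ->
  \prod_i g i %| p.
Proof.
elim: n g => [|n IHn] g cop gp; first by rewrite big_ord0 dvd1p.
rewrite big_ord_recl Gauss_dvdp ?gp ?IHn //=.
  by move=> i j ne_ij; apply: cop; rewrite (inj_eq lift_inj).
apply: (big_ind (fun q => coprimep _ q)); first exact: coprimep1.
  by move=> p1 p2 c1 c2; rewrite coprimepMr c1.
by move=> j _; apply: cop; rewrite neq_lift.
Qed.

Lemma natr_ffact (R : nzRingType) (m i : nat) :
  (m ^_ i)%:R = \prod_(l < i) (m%:R - l%:R) :> R.
Proof.
elim: i => [|i IHi]; first by rewrite big_ord0 ffactn0.
rewrite big_ord_recr /= -IHi ffactnSr natrM.
have [im|mi] := leqP i m; first by rewrite natrB.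
by rewrite ffact_small // !mul0r.
Qed.

Lemma sum_leq_ord (r t : nat) : (\sum_(j < t) (r <= j) = t - r)%N.
Proof.
elim: t => [|t IHt]; first by rewrite big_ord0.
by rewrite big_ord_recr /= IHt; case: leqP; lia.
Qed.

Section Multiplicity.

Variable F : fieldType.

(** The matrix sending a coefficient row to its first [s] Hasse derivatives at [a]; its kernel plays
    the role of [H_i]. *)
Definition hasse_eval (k s : nat) (a : F) : 'M[F]_(k, s) :=
  \matrix_(m, i) ('X^m)^`N(i).[a].

Definition hasse_wronskian (t k : nat) (B : 'M[F]_(t, k)) : 'M[{poly F}]_t :=
  \matrix_(j, i) (rVpoly (row j B))^`N(i).

Lemma mul_hasse_eval k s a (x : 'rV[F]_k) :
  x *m hasse_eval k s a = \row_i (rVpoly x)^`N(i).[a].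
Proof.
apply/rowP => i; rewrite [in RHS](row_sum_delta x) linear_sum !mxE.
rewrite linear_sum /= horner_sum; apply: eq_bigr => j _.
by rewrite !mxE !linearZ /= rVpoly_delta hornerZ.
Qed.

Lemma hasse_wronskianM t k (P : 'M[F]_t) (B : 'M[F]_(t, k)) :
  hasse_wronskian (P *m B) = map_mx polyC P *m hasse_wronskian B.
Proof.
apply/matrixP => i j; rewrite !mxE row_mul mulmx_sum_row !linear_sum /=.
by apply: eq_bigr => l _; rewrite !linearZ /= -mul_polyC !mxE.
Qed.

Lemma size_det_hasse_wronskian t k (B : 'M[F]_(t, k)) :
  (size (\det (hasse_wronskian B)) <= (t * k).+1)%N.
Proof.
rewrite /determinant; apply: (big_ind (fun q : {poly F} => (size q <= (t * k).+1)%N)).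
- by rewrite size_poly0.
- by move=> p q sp sq; rewrite (leq_trans (size_polyD _ _)) // geq_max sp.
move=> g _; rewrite -signr_odd mulr_sign.
rewrite (fun_if (fun q => size (polyseq q))) size_polyN if_same.
apply: leq_trans (size_poly_prod_leq _ _) _; apply: leq_trans (leq_subr _ _) _.
rewrite ltnS -[X in (_ <= X * k)%N]card_ord -sum_nat_const leq_sum // => j _.
rewrite mxE; apply/leq_sizeP => e ke; rewrite coef_nderivn.
rewrite nth_default ?mul0rn // (leq_trans (size_poly _ _)) //.
by rewrite (leq_trans ke) ?leq_addl.
Qed.

(** An invertible change of rows, which alters the determinant by a unit, puts a basis of the kernel
    part last. Every entry of those rows vanishes at [a] to order [s + 1 - t]. *)
Lemma dvdp_det_hasse_wronskian t k s a (B : 'M[F]_(t, k)) :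
  row_free B -> (t <= s)%N ->
  ('X - a%:P) ^+ ((s.+1 - t) * \rank (B :&: kermx (hasse_eval k s a))%MS)
    %| \det (hasse_wronskian B).
Proof.
move=> freeB ts; set E := hasse_eval k s a; set Y := B *m E.
set P := invmx (col_ebase Y).
have PY : P *m Y = pid_mx (\rank Y) *m row_ebase Y.
  by rewrite -{1}(mulmx_ebase Y) -mulmxA mulKmx ?col_ebase_unit.
have detP : (\det P)%:P %= 1.
  rewrite -size_poly_eq1 size_polyC.
  suff : P \in unitmx by rewrite unitmxE unitfE => ->.
  by rewrite unitmx_inv col_ebase_unit.
have detPB : \det (hasse_wronskian (P *m B)) %= \det (hasse_wronskian B).
  rewrite hasse_wronskianM det_mulmx det_map_mx.
  by rewrite -[X in _ %= X]mul1r eqp_mulr.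
rewrite -(eqp_dvdr _ detPB).
pose g (j : 'I_t) := if (j < \rank Y)%N then 1 else ('X - a%:P) ^+ (s.+1 - t).
suff <- : \prod_j g j = ('X - a%:P) ^+ ((s.+1 - t) * \rank (B :&: kermx E)%MS).
  apply: det_dvdp => j i; rewrite /g; case: ifP => [_|jY]; first exact: dvd1p.
  rewrite mxE; apply: dvdp_XsubC_exp_nderivn => l lt_l.
  rewrite nderivn_nderivn hornerMn.
  (* Here [i <= t - 1] and [l <= s - t], which explains the exponent [s + 1 - t]. *)
  have il : (i + l < s)%N by have := ltn_ord i; lia.
  have : (row j (P *m B) *m E) 0 (Ordinal il) = 0.
    rewrite -row_mul -mulmxA -/Y PY 2!mxE big1 // => h _.
    by rewrite mxE jY andbF mul0r.
  by rewrite mul_hasse_eval mxE /= => ->; rewrite mul0rn.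
have -> : \rank (B :&: kermx E)%MS = (\sum_(j < t) (\rank Y <= j))%N.
  by rewrite sum_leq_ord -[X in (X - _)%N](eqnP freeB) -(mxrank_mul_ker B E) addKn.
rewrite big_distrr expr_sum /=; apply: eq_bigr => j _; rewrite /g ltnNge.
by case: (_ <= _)%N; rewrite ?muln0 ?muln1.
Qed.

(** The sum is the value at [e] of a nonzero polynomial of degree below [t], and the integers below
    [k] stay distinct in [F]. *)
Lemma binomial_roots t k (q : 'I_t -> F) (Z : {set 'I_k}) :
  (forall m, (0 < m < k)%N -> m%:R != 0 :> F) -> (t <= k)%N ->
  (exists i, q i != 0) ->
  (forall e : 'I_k, e \in Z -> \sum_i q i *+ 'C(e, i) = 0) ->
  (#|Z| < t)%N.
Proof.
move=> char le_tk [i0 qi0] Z0.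
have fact_neq0 i : (i < k)%N -> i`!%:R != 0 :> F.
  elim: i => [|i IHi] ik; first by rewrite oner_eq0.
  by rewrite factS natrM mulf_neq0 ?IHi ?(ltnW ik) // char.
pose Q := \sum_i (q i / i`!%:R) *: \prod_(l < i) ('X - (l%:R)%:P) : {poly F}.
have Q_nat m : Q.[m%:R] = \sum_i q i *+ 'C(m, i).
  rewrite horner_sum; apply: eq_bigr => i _; rewrite hornerZ horner_prod.
  under eq_bigr => l _ do rewrite hornerXsubC.
  rewrite -natr_ffact -bin_ffact natrM mulrA [_ * _%:R * _]mulrAC.
  by rewrite divfK ?mulr_natr ?fact_neq0 // (leq_trans (ltn_ord i)).
(* The system is triangular: the value at [m] determines [q m] from the earlier coefficients. *)
have Q_neq0 : Q != 0.
  apply: contra_neq qi0 => Q0.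
  elim/ltn_ind: {i0}(val i0) {-2}i0 (erefl (val i0)) => m IHm i im.
  have : Q.[m%:R] = 0 by rewrite Q0 horner0.
  rewrite Q_nat (bigD1 i) //= im binn big1 ?addr0 // => j.
  rewrite -val_eqE /= im; case: (ltngtP j m) => // [jm|mj] _.
    by rewrite (IHm _ jm j erefl) mul0rn.
  by rewrite bin_small ?mulr0n.
have size_Q : (size Q <= t)%N.
  apply: (big_ind (fun q : {poly F} => (size q <= t)%N)) => [|p1 p2 s1 s2|i _].
  - by rewrite size_poly0.
  - by rewrite (leq_trans (size_polyD _ _)) // geq_max s1.
  rewrite (leq_trans (size_scale_leq _ _)) // size_prod_XsubC.
  by rewrite -[index_enum _]enumT size_enum_ord.
rewrite (leq_trans _ size_Q) // cardE.
rewrite -(size_map (fun e : 'I_k => e%:R : F)); apply: max_poly_roots => //.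
  apply/allP => _ /mapP[e eZ ->]; rewrite mem_enum in eZ.
  by rewrite rootE Q_nat Z0.
rewrite map_inj_uniq ?enum_uniq // => e1 e2.
wlog le12 : e1 e2 / (e1 <= e2)%N.
  by move=> wl e12; case/orP: (leq_total e1 e2) => /wl-> //.
move=> e12; apply/val_inj/eqP; rewrite eqn_leq le12 leqNgt; apply/negP => lt12.
have /eqP : (e2 - e1)%:R = 0 :> F by rewrite natrB // e12 subrr.
apply/negP/char; rewrite subn_gt0 lt12 (leq_ltn_trans (leq_subr _ _)) //.
Qed.

(* A linear relation [\sum_i v_i f^(i) = 0] valid on the row space of [B] becomes
   [\sum_i b_i X^i f^(i) = 0] with [b_i = v_i X^(t - i)]; its top coefficient
   confines the degrees of all nonzero [f] to the roots of a polynomial of degree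
   less than [t], while a space of dimension [t] has at least [t] degrees. *)
Lemma det_hasse_wronskian_neq0 t k (B : 'M[F]_(t, k)) :
  (forall m, (0 < m < k)%N -> m%:R != 0 :> F) -> row_free B ->
  \det (hasse_wronskian B) != 0.
Proof.
move=> char freeB; rewrite -det_tr; apply/det0P => -[v v0 vB].
have rel u : \sum_i v 0 i * (rVpoly (u *m B))^`N(i) = 0.
  rewrite mulmx_sum_row.
  under eq_bigr => i _ do rewrite !linear_sum mulr_sumr /=.
  rewrite exchange_big /= big1 // => j _.
  move/rowP/(_ j): vB; rewrite !mxE => vBj.
  transitivity (u 0 j *: \sum_i v 0 i * (hasse_wronskian B)^T i j);
    last by rewrite vBj scaler0.
  rewrite scaler_sumr; apply: eq_bigr => i _ /=.
  by rewrite !linearZ /= !mxE scalerAr.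
pose b (i : 'I_t) := v 0 i * 'X^(t - i).
pose c := (\max_i size (b i)).-1.
have size_max i : (size (b i) <= \max_i size (b i))%N.
  exact: (leq_bigmax (F := fun i => size (b i))).
have size_b i : (size (b i) <= c.+1)%N.
  by rewrite (leq_trans (size_max i)) // leqSpred.
have [i0 bi0] : exists i, (b i)`_c != 0.
  have /rV0Pn[i1 vi1] := v0.
  have b1 : b i1 != 0 by rewrite mulf_neq0 // monic_neq0 // monicXn.
  have t0 : (0 < #|'I_t|)%N by apply/card_gt0P; exists i1.
  have [i bmax] := bigop.eq_bigmax (fun i => size (b i)) t0.
  exists i; rewrite /c bmax -lead_coefE lead_coef_eq0 -size_poly_gt0 -bmax.
  by rewrite (leq_trans _ (size_max i1)) // size_poly_gt0.
pose Z := [set e : 'I_k | \sum_i (b i)`_c *+ 'C(e, i) == 0].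
have deg_Z u e : (size (rVpoly (u *m B)) = e.+1)%N ->
    \sum_i (b i)`_c *+ 'C(e, i) = 0.
  set f := rVpoly _ => sf.
  have fe : f`_e != 0.
    by rewrite -[e]/(e.+1.-1) -sf -lead_coefE lead_coef_eq0 -size_poly_gt0 sf.
  have : (\sum_i b i * ('X^i * f^`N(i)))`_(c + e) = 0.
    transitivity (('X^t * \sum_i v 0 i * f^`N(i))`_(c + e)); last first.
      by rewrite rel mulr0 coef0.
    congr (polyseq _)`_ _; rewrite mulr_sumr; apply: eq_bigr => i _.
    have -> : 'X^t = 'X^(t - i) * 'X^i :> {poly F}.
      by rewrite -exprD subnK // ltnW.
    by rewrite /b; ring.
  rewrite coef_sum => sum0; apply: (mulIf fe); rewrite mul0r -{}[RHS]sum0 mulr_suml.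
  apply: eq_bigr => i _; rewrite coefM_top ?coefXnM_nderivn ?mulrnAl ?mulrnAr //.
  apply/leq_sizeP => l el; rewrite coefXnM_nderivn nth_default ?mul0rn //.
  by rewrite sf.
have le_tk : (t <= k)%N by rewrite -(eqnP freeB) rank_leq_col.
suff : (t <= #|Z|)%N.
  rewrite leqNgt (@binomial_roots _ _ (fun i => (b i)`_c)) //; first by exists i0.
  by move=> e; rewrite inE => /eqP.
(* Keeping only the coefficients with index in [Z] is injective on the row space of [B], since a
   leading coefficient survives. *)
suff : row_free (colsub (enum_val : 'I_#|Z| -> 'I_k) B).
  by move/eqnP <-; apply: rank_leq_col.
apply: inj_row_free => u; rewrite mulmx_colsub => uB.
apply/eqP/contraT => u0.
have f0 : rVpoly (u *m B) != 0.
  apply: contraNneq u0 => f0; rewrite -(mulmx_free_eq0 u freeB).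
  by rewrite -(rVpolyK (u *m B)) f0 linear0.
have sf : (size (rVpoly (u *m B))).-1.+1 = size (rVpoly (u *m B)).
  by rewrite prednK // size_poly_gt0.
have ek : ((size (rVpoly (u *m B))).-1 < k)%N by rewrite sf size_poly.
pose e := Ordinal ek.
have eZ : e \in Z by rewrite inE (deg_Z u) // sf.
have : (rVpoly (u *m B))`_e = 0.
  rewrite coef_rVpoly_ord; move/rowP/(_ (enum_rank_in eZ e)): uB.
  by rewrite !mxE enum_rankK_in.
by move/eqP; rewrite -lead_coefE lead_coef_eq0 (negPf f0).
Qed.

(** The zeros forced at the distinct points [alpha i] give coprime factors of a nonzero determinant,
    so their total order is at most its degree. *)
Lemma subspace_design n k s (alpha : 'I_n -> F) (U : 'M[F]_k) :
  (forall m, (0 < m < k)%N -> m%:R != 0 :> F) -> injective alpha ->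
  (\rank U <= s)%N ->
  (\sum_i (s.+1 - \rank U) * \rank (U :&: kermx (hasse_eval k s (alpha i)))%MS
     <= \rank U * k)%N.
Proof.
move=> char inj_a le_Us; pose B := row_base U.
have freeB : row_free B := row_base_free U.
have eqBU i : \rank (U :&: kermx (hasse_eval k s (alpha i)))%MS
    = \rank (B :&: kermx (hasse_eval k s (alpha i)))%MS.
  by apply/eqP; rewrite eqn_leq !mxrankS ?capmxS ?eq_row_base.
have det0 := det_hasse_wronskian_neq0 char freeB.
pose g (i : 'I_n) := ('X - (alpha i)%:P) ^+
  ((s.+1 - \rank U) * \rank (U :&: kermx (hasse_eval k s (alpha i)))%MS).
have g_dvd : \prod_i g i %| \det (hasse_wronskian B).
  apply: prod_dvdp => [i j ne_ij|i].
    rewrite coprimep_expl // coprimep_expr // coprimep_XsubC2 // subr_eq0.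
    by rewrite (inj_eq inj_a) eq_sym.
  by rewrite /g eqBU dvdp_det_hasse_wronskian.
have := leq_trans (dvdp_leq det0 g_dvd) (size_det_hasse_wronskian B).
rewrite size_prod; last by move=> i _; rewrite expf_neq0 ?polyXsubC_eq0.
under eq_bigr => i _ do rewrite /g size_exp_XsubC -addn1.
by rewrite big_split /= sum_nat_const muln1 card_ord -addSn addnK ltnS.
Qed.

End Multiplicity.

(** * List decoding *)

Lemma nclass0 (F : finFieldType) d (X : {set 'rV[F]_d}) : nclass 0 X = #|X|.
Proof.
rewrite /nclass card_in_imset // => x y _ _ /eqP.
by rewrite eq_cokermx submx0 subr_eq0 => /eqP.
Qed.

Lemma affine_hull (F : finFieldType) d (T : {set 'rV[F]_d}) (L : nat) :
  #|T| = L.+1 ->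
  exists2 B : 'M[F]_d, (\rank B <= L)%N &
    forall x y, x \in T -> y \in T -> (x - y <= B)%MS.
Proof.
move=> cT; have /card_gt0P[x0 Tx0] : (0 < #|T|)%N by rewrite cT.
exists (\sum_(x in T :\ x0) <<x - x0>>)%MS.
  have cT0 : #|T :\ x0| = L by move: (cardsD1 x0 T); rewrite Tx0 cT => -[].
  rewrite -[X in (_ <= X)%N]cT0 -sum1_card.
  apply: (big_ind2 (fun (A : 'M_d) r => (\rank A <= r)%N)) => [|A1 r1 A2 r2 h1 h2|x _].
  - by rewrite mxrank0.
  - by rewrite (leq_trans (mxrank_adds_leqif A1 A2)) ?leq_add.
  by rewrite mxrank_gen rank_rV leq_b1.
have sub_x0 x : x \in T -> (x - x0 <= \sum_(x in T :\ x0) <<x - x0>>)%MS.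
  move=> Tx; have [->|xx0] := eqVneq x x0; first by rewrite subrr sub0mx.
  by rewrite (sumsmx_sup x) ?genmxE // !inE xx0.
move=> x y Tx Ty; have -> : x - y = (x - x0) - (y - x0).
  by rewrite opprB addrA subrK.
by rewrite addmx_sub ?eqmx_opp ?sub_x0.
Qed.

(** [feasible_bound] is used with unit weights between 0 and the span of the differences;
    [subspace_design] gives feasibility, as [s + 1 - dim U >= s + 1 - L]. *)
Lemma multiplicity_agreement (F : finFieldType) (R : realFieldType) n k s L
    (alpha : 'I_n -> F) (y : 'I_n -> 'rV[F]_s) (T : {set 'rV[F]_k}) :
  (forall m, (0 < m < k)%N -> m%:R != 0 :> F) -> injective alpha ->
  (L <= s)%N -> #|T| = L.+1 ->
  \sum_(i < n) #|[set x in T | x *m hasse_eval k s (alpha i) == y i]|.-1%:R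
    <= k%:R / (s.+1 - L)%:R * L%:R :> R.
Proof.
move=> char inj_a le_Ls cT; have [B rB TB] := affine_hull cT.
pose H i := kermx (hasse_eval k s (alpha i)).
pose S i := [set x : 'rV[F]_k | x *m hasse_eval k s (alpha i) == y i].
have m_gt0 : 0 < (s.+1 - L)%:R :> R by rewrite ltr0n subn_gt0 ltnS.
have := @feasible_bound F R k _ H S (k%:R / (s.+1 - L)%:R) 0 B (fun=> 1).
rewrite /agreement_bound => /(_ _ _ _ _ _ T TB); rewrite nclass0 cT /=.
move=> bound; apply: le_trans (bound _ _ _ _ _).
- apply: ler_sum => i _; rewrite mul1r nclass0 ler_nat; apply: eq_leq.
  by congr (_.-1); apply: eq_card => x; rewrite !inE andbC.
- by rewrite divr_ge0.
- move=> i x z; rewrite !inE => /eqP xy /eqP zy.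
  by apply/sub_kermxP; rewrite mulmxBl xy zy subrr.
- exact: sub0mx.
- by move=> i; apply: ler01.
move=> U _ sUB; rewrite /slack mxrank0 subr0 subr_ge0.
have rU : (\rank U <= L)%N := leq_trans (mxrankS sUB) rB.
have := subspace_design char inj_a (leq_trans rU le_Ls).
rewrite -big_distrr /= -(ler_nat R) !natrM natr_sum => design.
rewrite mulrAC ler_pdivlMr // mulrC [k%:R * _]mulrC.
apply: le_trans design.
under eq_bigr => i _ do rewrite mul1r /relrank cap0mx mxrank0 subr0.
by rewrite ler_wpM2r ?sumr_ge0 // ler_nat leq_sub2l.
Qed.

(** Double counting, with [m <= 1 + m.-1] at each coordinate. *)
Lemma sum_card_agreement (F : finFieldType) n k s (alpha : 'I_n -> F)
    (y : 'I_n -> 'rV[F]_s) (T : {set 'rV[F]_k}) :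
  (\sum_(x in T) #|[set i | x *m hasse_eval k s (alpha i) == y i]| <=
     n + \sum_(i < n) #|[set x in T | x *m hasse_eval k s (alpha i) == y i]|.-1)%N.
Proof.
under eq_bigr => x _ do rewrite -sum1_card big_mkcond.
rewrite exchange_big /= -[n in (n + _)%N]card_ord -sum1_card -big_split /=.
apply: leq_sum => i _; apply: leq_trans (leqSpred _); apply: eq_leq.
rewrite -sum1_card [RHS]big_mkcond [LHS]big_mkcond /=; apply: eq_bigr => x _.
by rewrite !inE; case: (x \in T).
Qed.

Theorem corollaryA10 (R : realType) (eps rate : R) (N k p L s n : nat)
    (alpha : 'I_n -> 'F_p) :
  0 < eps ->
  (1 <= k)%N -> (k < N)%N ->
  prime p -> (k < p)%N ->
  rate = k%:R / N%:R ->
  (1 <= L)%N ->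
  L%:R > (1 - rate - eps) / eps ->
  (1 <= s)%N -> (s %| N)%N ->
  s%:R > L%:R * (L%:R - 1) * rate / (eps * L%:R - (1 - rate - eps))
         + L%:R - 1 ->
  n = (N %/ s)%N ->
  injective alpha ->
  list_decodable (mult_code k s alpha) (1 - rate - eps) L.
Proof.
move=> eps0 k1 kN pr_p kp rateE L1 hL s1 sN hs nE inj_a y.
have char m : (0 < m < k)%N -> m%:R != 0 :> 'F_p.
  case/andP=> m0 mk; rewrite -(dvdn_pcharf (pchar_Fp pr_p)) gtnNdvd //.
  exact: ltn_trans kp.
have NE : N = (n * s)%N by rewrite nE divnK.
have n0 : (0 < n)%N by move: kN; rewrite NE; case: (n).
have sR : 0 < s%:R :> R by rewrite ltr0n.
have nR : 0 < n%:R :> R by rewrite ltr0n.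
have NR : N%:R = n%:R * s%:R :> R by rewrite NE natrM.
have rate0 : 0 < rate by rewrite rateE divr_gt0 ?ltr0n // (leq_ltn_trans _ kN).
have L1R : 1 <= L%:R :> R by rewrite ler1n.
pose E := eps * L%:R - (1 - rate - eps).
have E0 : 0 < E by move: hL; rewrite ltr_pdivrMr // /E => hL; lra.
have Q0 : 0 <= L%:R * (L%:R - 1) * rate / E.
  by rewrite divr_ge0 ?(ltW E0) // mulr_ge0 ?(ltW rate0) // mulr_ge0 ?subr_ge0.
(* The fraction [Q0] is nonnegative, so the bound on [s] gives [s > L - 1]. *)
have le_Ls : (L <= s)%N.
  rewrite -ltnS -(ltr_nat R) -natr1; rewrite -/E in hs; lra.
have mE : (s.+1 - L)%:R = s%:R + 1 - L%:R :> R.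
  by rewrite natrB ?natr1 // (leq_trans le_Ls).
have m0 : 0 < s%:R + 1 - L%:R :> R by rewrite -/E in hs; lra.
have hE : L%:R * (L%:R - 1) * rate < (s%:R + 1 - L%:R) * E.
  by rewrite -ltr_pdivrMr //; rewrite -/E in hs; lra.
rewrite leqNgt; apply/negP => /card_geqP[cs [uniq_cs size_cs sub_cs]].
(* A message row for each codeword; the default 0 is never reached on [cs]. *)
pose pol (c : {ffun 'I_n -> 'rV['F_p]_s}) : 'rV['F_p]_k :=
  odflt 0 [pick v | mult_enc s alpha (rVpoly v) == c].
have polK c : c \in cs -> mult_enc s alpha (rVpoly (pol c)) = c.
  move/sub_cs; rewrite inE => /andP[/mult_codeP[f sz_f ->] _].
  rewrite /pol; case: pickP => [v /eqP //|/(_ (poly_rV f))].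
  by rewrite poly_rV_K // eqxx.
pose T := [set pol c | c in cs].
have cT : #|T| = L.+1.
  rewrite card_in_imset; last by move=> c d cc dc e; rewrite -(polK c) // e polK.
  by rewrite (card_uniqP uniq_cs).
have le1 := multiplicity_agreement R y char inj_a le_Ls cT.
have le2 := sum_card_agreement alpha y T.
have agree x : x \in T ->
    (rate + eps) * n%:R <= #|[set i | x *m hasse_eval k s (alpha i) == y i]|%:R.
  case/imsetP => c cc ->; move: (sub_cs c cc); rewrite inE => /andP[_].
  rewrite /rel_dist ler_pdivrMr // => dist.
  have : (#|[set i | pol c *m hasse_eval k s (alpha i) == y i]|
      + #|[set i | c i != y i]| = n)%N.
    rewrite -[RHS]card_ord -(cardC [set i | c i == y i]).
    congr (_ + _)%N; apply: eq_card => i; rewrite !inE //.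
    by rewrite mul_hasse_eval -[in RHS](polK c) // ffunE.
  by move/(congr1 (fun m => m%:R : R)); rewrite natrD; lra.
have : L.+1%:R * ((rate + eps) * n%:R) <= n%:R + k%:R / (s.+1 - L)%:R * L%:R.
  rewrite -natr_sum in le1; apply: le_trans (lerD (lexx _) le1).
  move: le2; rewrite -(ler_nat R) natrD; apply: le_trans.
  by rewrite natr_sum -cT mulr_natl -sumr_const; apply: ler_sum.
have kE : k%:R = rate * (n%:R * s%:R).
  by rewrite rateE NR divfK // mulf_neq0 // gt_eqF.
rewrite mE kE -natr1 => le3.
have {}le3 : (L%:R + 1) * (rate + eps) * (s%:R + 1 - L%:R)
    <= s%:R + 1 - L%:R + rate * s%:R * L%:R.
  rewrite -(ler_pM2r nR).
  have := ler_wpM2r (ltW m0) le3; rewrite [in X in _ <= X]mulrDl.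
  rewrite [_ / _ * _]mulrAC divfK ?gt_eqF //; lra.
(* With [m = s + 1 - L] and [s = m + L - 1], [le3] becomes [m * E <= L * (L - 1) * rate], against
   [hE]. *)
by rewrite /E in hE; lra.
Qed.
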